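(* Let $k$ be an algebraically closed field, let $m\ge 2$ and $r\ge 2$. Let $f_1,\dots,f_r$ be irreducible forms (homogeneous polynomials) in $k[x_1,\dots,x_m]$ defining distinct varieties $Z(f_1),\dots,Z(f_r)$ in $\mathbb A^m$. Assume the set $\{\deg(f_1),\dots,\deg(f_r)\}$ generates the unit ideal in $\mathbb Z$, and that $n=\deg(f_1)+\dots+\deg(f_r)$ is invertible in $k$. If $X$ denotes the affine variety in $\mathbb A^m$ defined by $f_1\dotsm f_r=1$, then $$\mathcal O^\ast(X)/k^\ast=\langle f_1\rangle\times\dotsm\times\langle f_{r-1}\rangle,$$ that is, $\mathcal O^\ast(X)/k^\ast$ is a free $\mathbb Z$-module with basis the classes of $f_1,\dots,f_{r-1}$.
   Context: $\mathcal O(X)=k[x_1,\dots,x_m]/(f_1\dotsm f_r-1)$ is the coordinate ring of $X$ and $\mathcal O^\ast(X)$ is its group of units. $Z(f)$ is the zero set of $f$, and $\langle f_i\rangle$ is the (infinite cyclic) subgroup generated by the class of $f_i$. *)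

(* Defs.v *)
From HB Require Import structures.
From mathcomp Require Import all_boot all_order all_algebra.
From mathcomp Require Import generic_quotient ring_quotient.
From mathcomp Require Import boolp classical_sets.
From mathcomp Require Import mpoly.

Set Implicit Arguments.
Unset Strict Implicit.
Unset Printing Implicit Defensive.

Import GRing.Theory.
Local Open Scope ring_scope.
Local Open Scope quotient_scope.

(* ssralg's ring quotients require a proper ideal, so that the quotient is
   nontrivial.  To make R / (g) meaningful for every g, it is equipped here with
   the structure of a possibly trivial ring (comPzRingType). *)
Section PrincipalQuotient.
Variables (R : comNzRingType) (g : R).

Definition principal_ideal : {pred R} := fun x => `[< exists a, x = a * g >].

Lemma principal_idealP x : reflect (exists a, x = a * g) (x \in principal_ideal).
Proof. exact: asboolP. Qed.

Lemma principal_ideal_zmod_closed : zmod_closed principal_ideal.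
Proof.
split; first by apply/principal_idealP; exists 0; rewrite mul0r.
move=> _ _ /principal_idealP[a ->] /principal_idealP[b ->].
by apply/principal_idealP; exists (a - b); rewrite mulrBl.
Qed.
HB.instance Definition _ :=
  GRing.isZmodClosed.Build R principal_ideal principal_ideal_zmod_closed.

Lemma principal_idealMr a x : x \in principal_ideal -> a * x \in principal_ideal.
Proof.
move=> /principal_idealP[b ->]; apply/principal_idealP.
by exists (a * b); rewrite mulrA.
Qed.

Definition quot_ring : Type := {ideal_quot principal_ideal}.
HB.instance Definition _ := Choice.on quot_ring.
HB.instance Definition _ := GRing.Zmodule.on quot_ring.
HB.instance Definition _ := ZmodQuotient.on quot_ring.

Definition quot_class (x : R) : quot_ring := \pi_{ideal_quot principal_ideal} x.
Definition quot_one : quot_ring := quot_class 1.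
Definition quot_mul (x y : quot_ring) : quot_ring :=
  quot_class (repr x * repr y).

Lemma quot_classP x y :
  quot_class x = quot_class y <-> exists a, x - y = a * g.
Proof.
split=> [/eqP|h].
  by rewrite /quot_class -Quotient.idealrBE => /principal_idealP.
by apply/eqP; rewrite /quot_class -Quotient.idealrBE; apply/principal_idealP.
Qed.

Lemma quot_class_repr (u : quot_ring) : quot_class (repr u) = u.
Proof. exact: reprK. Qed.

Lemma quot_classM : {morph quot_class : x y / x * y >-> quot_mul x y}.
Proof.
move=> x y; apply/quot_classP.
have /quot_classP[a xE] := quot_class_repr (quot_class x).
have /quot_classP[b yE] := quot_class_repr (quot_class y).
exists (- (a * repr (quot_class y) + x * b)).
rewrite mulNr mulrDl mulrAC -xE -mulrA -yE mulrBl mulrBr.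
by rewrite addrA subrK opprB.
Qed.

Lemma quot_classD : {morph quot_class : x y / x + y}.
Proof. by move=> x y; rewrite /quot_class piE. Qed.

Lemma quot_mulA : associative quot_mul.
Proof.
move=> x y z; rewrite -(quot_class_repr x) -(quot_class_repr y).
by rewrite -(quot_class_repr z) -!quot_classM mulrA.
Qed.

Lemma quot_mulC : commutative quot_mul.
Proof. by move=> x y; rewrite /quot_mul mulrC. Qed.

Lemma quot_mul1 : left_id quot_one quot_mul.
Proof. by move=> x; rewrite -(quot_class_repr x) -quot_classM mul1r. Qed.

Lemma quot_mulDl : left_distributive quot_mul +%R.
Proof.
move=> x y z; rewrite -(quot_class_repr x) -(quot_class_repr y).
rewrite -(quot_class_repr z) -quot_classD -!quot_classM mulrDl.
exact: quot_classD.
Qed.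

HB.instance Definition _ :=
  GRing.Zmodule_isComPzRing.Build quot_ring
    quot_mulA quot_mulC quot_mul1 quot_mulDl.

Lemma quot_class_zmod_morphism : zmod_morphism quot_class.
Proof. by move=> x y; rewrite /quot_class piE. Qed.
HB.instance Definition _ :=
  GRing.isZmodMorphism.Build R quot_ring quot_class quot_class_zmod_morphism.

Lemma quot_class_monoid_morphism : monoid_morphism quot_class.
Proof. by split=> // x y; rewrite quot_classM. Qed.
HB.instance Definition _ :=
  GRing.isMonoidMorphism.Build R quot_ring quot_class quot_class_monoid_morphism.

End PrincipalQuotient.

(* The group of units A^* of a commutative ring: a unit is given together with
   its inverse.  The (multiplicative) group law is written additively, so that
   A^* is a zmodType and u *~ e is the e-th power of u. *)
Section Units.
Variable A : comPzRingType.

Definition units : Type := {p : A * A | p.1 * p.2 == 1}.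
HB.instance Definition _ := Choice.on units.

Definition mk_unit (a b : A) (ab1 : a * b = 1) : units :=
  exist (fun p : A * A => p.1 * p.2 == 1) (a, b) (introT eqP ab1).

Definition unit_val (u : units) : A := (sval u).1.
Definition unit_inv (u : units) : A := (sval u).2.

Lemma unit_valV u : unit_val u * unit_inv u = 1.
Proof. exact: (eqP (svalP u)). Qed.

Lemma unit_val_inj : injective unit_val.
Proof.
move=> [[u u'] uP] [[v v'] vP]; rewrite /unit_val /= => uv.
apply/val_inj; rewrite /= uv; congr pair.
move/eqP: uP; move/eqP: vP; rewrite /= uv => vv' vu'.
by rewrite -[u']mulr1 -vv' mulrA (mulrC u') vu' mul1r.
Qed.

Definition units0 : units := mk_unit (mulr1 1).

Lemma units_opp_proof u : unit_inv u * unit_val u = 1.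
Proof. by rewrite mulrC unit_valV. Qed.
Definition units_opp u : units := mk_unit (units_opp_proof u).

Lemma units_add_proof u v :
  (unit_val u * unit_val v) * (unit_inv u * unit_inv v) = 1.
Proof. by rewrite mulrACA !unit_valV mulr1. Qed.
Definition units_add u v : units := mk_unit (units_add_proof u v).

Lemma units_addA : associative units_add.
Proof. by move=> u v w; apply: unit_val_inj; rewrite /unit_val /= mulrA. Qed.
Lemma units_addC : commutative units_add.
Proof. by move=> u v; apply: unit_val_inj; rewrite /unit_val /= mulrC. Qed.
Lemma units_add0 : left_id units0 units_add.
Proof. by move=> u; apply: unit_val_inj; rewrite /unit_val /= mul1r. Qed.
Lemma units_addN : left_inverse units0 units_opp units_add.
Proof. by move=> u; apply: unit_val_inj; exact: units_opp_proof. Qed.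

HB.instance Definition _ :=
  GRing.isZmodule.Build units units_addA units_addC units_add0 units_addN.

Lemma unit_val0 : unit_val 0 = 1. Proof. by []. Qed.
Lemma unit_valD u v : unit_val (u + v) = unit_val u * unit_val v.
Proof. by []. Qed.
Lemma unit_valN u : unit_val (- u) = unit_inv u. Proof. by []. Qed.

End Units.

Definition is_Zbasis (V : zmodType) (I : finType) (b : I -> V) : Prop :=
  (forall v : V, exists e : I -> int, v = \sum_i b i *~ e i) /\
  (forall e : I -> int, \sum_i b i *~ e i = 0 -> forall i, e i = 0).

Definition irreducible_elt (R : idomainType) (x : R) : Prop :=
  [/\ x != 0, x \isn't a GRing.unit &
      forall a b, x = a * b -> a \is a GRing.unit \/ b \is a GRing.unit].

Section Forms.
Variables (k : fieldType) (m : nat).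

(* msize 0 = 0 and msize p = deg p + 1 for p != 0. *)
Definition mdegree (p : {mpoly k[m]}) : nat := (msize p).-1.

Definition is_form (p : {mpoly k[m]}) : Prop := p \is (mdegree p).-homog.

Definition zero_set (p : {mpoly k[m]}) : set ('I_m -> k) :=
  [set x | p.@[x] = 0]%classic.

Variables (r : nat) (f : 'I_r -> {mpoly k[m]}).

(* O(X) for X : f_1 * ... * f_r = 1. *)
Definition coord_ring : comPzRingType := quot_ring (\prod_(i < r) f i - 1).

Definition coord_class : {mpoly k[m]} -> coord_ring :=
  @quot_class _ (\prod_(i < r) f i - 1).

(* The image of k^* in O(X)^*. *)
Definition scalar_units : {pred units coord_ring} :=
  fun u => `[< exists2 c : k, c != 0 & unit_val u = coord_class c%:MP >].

Lemma scalar_unitsP u :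
  reflect (exists2 c : k, c != 0 & unit_val u = coord_class c%:MP)
          (u \in scalar_units).
Proof. exact: asboolP. Qed.

Lemma scalar_units_zmod_closed : zmod_closed scalar_units.
Proof.
split; first by apply/scalar_unitsP; exists 1; rewrite ?oner_neq0.
move=> u v /scalar_unitsP[c c0 uE] /scalar_unitsP[d d0 vE].
apply/scalar_unitsP; exists (c / d); first by rewrite mulf_neq0 ?invr_neq0.
rewrite unit_valD unit_valN uE.
have vV : coord_class d%:MP * coord_class (d^-1)%:MP = 1.
  by rewrite /coord_class -rmorphM -mpolyCM divff // rmorph1.
have -> : unit_inv v = coord_class (d^-1)%:MP.
  by rewrite -[LHS]mulr1 -vV mulrA -vE units_opp_proof mul1r.
by rewrite /coord_class -rmorphM -mpolyCM.
Qed.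
HB.instance Definition _ :=
  GRing.isZmodClosed.Build (units coord_ring) scalar_units
    scalar_units_zmod_closed.

(* The abelian group O(X)^* / k^*, written additively. *)
Definition units_mod_scalars : zmodType := {ideal_quot scalar_units}.

Lemma factor_unit_proof (i : 'I_r) :
  coord_class (f i) * coord_class (\prod_(j < r | j != i) f j) = 1.
Proof.
have fE : f i * \prod_(j < r | j != i) f j = \prod_(j < r) f j.
  by rewrite [RHS](bigD1 i).
rewrite /coord_class -rmorphM fE -[RHS](rmorph1 (quot_class _)).
by apply/quot_classP; exists 1; rewrite mul1r.
Qed.

(* f_i as a unit of O(X), its inverse being the product of the other f_j. *)
Definition factor_unit (i : 'I_r) : units coord_ring :=
  mk_unit (factor_unit_proof i).

Definition factor_class (i : 'I_r) : units_mod_scalars :=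
  \pi_{ideal_quot scalar_units} (factor_unit i).

End Forms.

Arguments scalar_units {k m r} f.
Arguments coord_class {k m r} f.
Arguments units_mod_scalars {k m r} f.

(* Main.v *)
Require Import Defs.
From HB Require Import structures.
From mathcomp Require Import all_boot all_order all_algebra.
From mathcomp Require Import generic_quotient ring_quotient.
From mathcomp Require Import boolp classical_sets.
From mathcomp Require Import mpoly zify.

Set Implicit Arguments.
Unset Strict Implicit.
Unset Printing Implicit Defensive.

Import GRing.Theory.
Local Open Scope ring_scope.
Local Open Scope quotient_scope.

(** Write F for the product of the f_i, a form of degree n.  Since F - 1 is
    homogeneous for degrees read modulo n, the coordinate ring k[x]/(F - 1) is
    graded by Z/n: an element has a unique component in each residue class,
    and every component lifts to a form, well defined up to powers of F.

    The polynomial ring is factorial ([factorial_mpoly], by Gauss's lemma), so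
    each irreducible f_i is prime and has a valuation v_i on k[x].  On a form h
    the rational number v_i(h) - deg(h)/n does not change when h is multiplied
    by F; it therefore depends only on the class of h, and forms in different
    residue classes have values that differ modulo Z.  Hence in a sum of
    components the least value is attained by one component only, and the
    product of two elements has, for each i, a unique component product of
    least value, which survives.

    Let w w' = 1 with components W_j and W'_l.  The surviving product has to be
    the component 1, of value 0, so all the products W_j W'_l have value at
    least 0 for every i ([component_valuation]).  When j + l is not 0 modulo n,
    this means that a power of F of larger degree divides W_j W'_l, so this
    product vanishes ([component_unique]).  Some product with j + l = 0 is
    nonzero, and k[x] is a domain: only one component of w is nonzero.  A unit
    is thus the class of a form, which divides a power of F, and by unique
    factorization it is a scalar times a monomial in the f_i
    ([unit_class_monomial]).

    So the classes of the f_i generate the units modulo scalars.  A relation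
    between them gives an equality of scalar multiples of two monomials modulo
    F - 1; both are forms, hence they agree in k[x] after multiplication by
    powers of F, and comparing exponents shows that all the coefficients of the
    relation are equal ([factor_class_relation]).  The relations are therefore
    the multiples of [f_1] + ... + [f_r] = 0, which eliminates [f_r]. *)

(** * Prime elements and unique factorization *)

Section Factoriality.
Variable D : idomainType.
Implicit Types (p x y z u : D) (s : seq D).

Definition divides x y : Prop := exists z, y = z * x.

Lemma divides_mull x y z : divides x y -> divides x (z * y).
Proof. by case=> t ->; exists (z * t); rewrite mulrA. Qed.

Lemma divides_mulr x y z : divides x y -> divides x (y * z).
Proof. by rewrite mulrC; apply: divides_mull. Qed.

Lemma dividesD x y z : divides x y -> divides x z -> divides x (y + z).
Proof. by move=> [a ->] [b ->]; exists (a + b); rewrite mulrDl. Qed.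

Lemma divides_sum (I : Type) (r : seq I) (P : pred I) (G : I -> D) x :
  (forall i, P i -> divides x (G i)) -> divides x (\sum_(i <- r | P i) G i).
Proof.
move=> GP; elim/big_rec: _ => [|i y Pi]; first by exists 0; rewrite mul0r.
by apply: dividesD; apply: GP.
Qed.

Record prime_elt p : Prop := PrimeElt {
  prime_elt_neq0 : p != 0;
  prime_elt_nonunit : p \isn't a GRing.unit;
  prime_eltM : forall a b, divides p (a * b) -> divides p a \/ divides p b }.

Lemma prime_elt_not_divides_unit p u :
  prime_elt p -> u \is a GRing.unit -> ~ divides p u.
Proof.
move=> pp uu [z uE]; move: uu; rewrite uE unitrM.
by rewrite (negbTE (prime_elt_nonunit pp)) andbF.
Qed.

Lemma prime_elt_not_dividesM p x y :
  prime_elt p -> ~ divides p x -> ~ divides p y -> ~ divides p (x * y).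
Proof. by move=> pp px py /(prime_eltM pp)[]. Qed.

Lemma prime_elt_not_dividesX p x e :
  prime_elt p -> ~ divides p x -> ~ divides p (x ^+ e).
Proof.
move=> pp px; elim: e => [|e IHe].
  by rewrite expr0; apply: prime_elt_not_divides_unit => //; apply: unitr1.
by rewrite exprS; apply: prime_elt_not_dividesM.
Qed.

Definition prime_seq s : Prop := forall p, p \in s -> prime_elt p.

(** Unique factorization stated through primes rather than irreducibles:
    uniqueness is then automatic. *)
Definition factorial_ring : Prop :=
  forall x, x != 0 -> exists2 us : D * seq D, us.1 \is a GRing.unit &
    prime_seq us.2 /\ x = us.1 * \prod_(p <- us.2) p.

Lemma prime_seq_cat s1 s2 :
  prime_seq s1 -> prime_seq s2 -> prime_seq (s1 ++ s2).
Proof. by move=> ps1 ps2 q; rewrite mem_cat => /orP[/ps1|/ps2]. Qed.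

(** Each prime of the factorization goes into one of the two factors; this is
    the unique factorization of divisors. *)
Lemma factor_prime_prod s x y u : prime_seq s -> u \is a GRing.unit ->
    x * y = u * \prod_(p <- s) p ->
  exists u1 u2 s1 s2, [/\ u1 \is a GRing.unit, u2 \is a GRing.unit,
    perm_eq (s1 ++ s2) s, x = u1 * \prod_(p <- s1) p &
    y = u2 * \prod_(p <- s2) p].
Proof.
elim: s x y => [|p s IHs] x y ps uu.
  rewrite big_nil mulr1 => xyE; move: uu; rewrite -xyE unitrM => /andP[xu yu].
  by exists x, y, [::], [::]; split=> //; rewrite big_nil mulr1.
rewrite big_cons mulrCA => xyE.
have pp : prime_elt p by apply: ps; rewrite inE eqxx.
have {}ps : prime_seq s by move=> q qs; apply: ps; rewrite inE qs orbT.
have p0 := prime_elt_neq0 pp.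
have : divides p (x * y) by exists (u * \prod_(q <- s) q); rewrite xyE mulrC.
case/(prime_eltM pp)=> -[z zE]; rewrite {}zE in xyE *.
- have zyE : z * y = u * \prod_(q <- s) q.
    by apply: (mulfI p0); rewrite -xyE mulrA (mulrC p).
  have [u1 [u2 [s1 [s2 [u1u u2u ss -> ->]]]]] := IHs _ _ ps uu zyE.
  exists u1, u2, (p :: s1), s2; split=> //; first by rewrite /= perm_cons.
  by rewrite big_cons mulrAC mulrA.
- have xzE : x * z = u * \prod_(q <- s) q.
    by apply: (mulfI p0); rewrite -xyE [RHS]mulrA [LHS]mulrC.
  have [u1 [u2 [s1 [s2 [u1u u2u ss -> ->]]]]] := IHs _ _ ps uu xzE.
  exists u1, u2, s1, (p :: s2); split=> //.
    by rewrite -cat1s perm_catCA perm_cons.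
  by rewrite big_cons mulrAC mulrA.
Qed.

(** The number of primes drops on division by a prime, which bounds inductions
    that strip prime factors. *)
Lemma factor_prime_cofactor p y s u : prime_elt p -> prime_seq s ->
    u \is a GRing.unit -> p * y = u * \prod_(q <- s) q ->
  exists u2 s2, [/\ u2 \is a GRing.unit, prime_seq s2,
    (size s2 < size s)%N & y = u2 * \prod_(q <- s2) q].
Proof.
move=> pp ps uu /(factor_prime_prod ps uu).
case=> u1 [u2 [s1 [s2 [u1u u2u ss pE yE]]]]; exists u2, s2; split=> //.
  by move=> q qs2; apply: ps; rewrite -(perm_mem ss) mem_cat qs2 orbT.
rewrite -(perm_size ss) size_cat; case: s1 pE {ss} => [|q s1] pE /=.
  by have := prime_elt_nonunit pp; rewrite pE big_nil mulr1 u1u.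
by rewrite addSn ltnS leq_addl.
Qed.

(** An irreducible element is associate to any of its prime factors. *)
Lemma irreducible_prime x : factorial_ring -> irreducible_elt x -> prime_elt x.
Proof.
move=> ufdD [x0 xnu xirr]; have [[u [|p s]] /= uu [ps xE]] := ufdD x x0.
  by move: xnu; rewrite xE big_nil mulr1 uu.
have pp : prime_elt p by apply: ps; rewrite inE eqxx.
rewrite big_cons mulrCA in xE; case: (xirr _ _ xE) => [pu|ru].
  by have := prime_elt_nonunit pp; rewrite pu.
set c := u * _ in xE ru.
have pE : p = c^-1 * x by rewrite xE mulrCA mulVr ?mulr1.
split=> // a b [z abE].
have : divides p (a * b) by exists (z * c); rewrite abE xE mulrAC mulrA.
by case/(prime_eltM pp)=> -[t ->]; [left|right]; exists (t * c^-1);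
  rewrite {1}pE mulrA.
Qed.

(** * Valuations at a prime *)

Definition exact_power p x e : Prop :=
  exists2 y, x = y * p ^+ e & ~ divides p y.

(** At a prime p, the junk value 0 is taken for x = 0. *)
Definition valuation p x : nat := xget 0%N [set e | exact_power p x e]%classic.

Section Valuation.
Variable p : D.
Hypothesis pp : prime_elt p.
Let p0 := prime_elt_neq0 pp.

Lemma exact_power_uniq x d e :
  exact_power p x d -> exact_power p x e -> d = e.
Proof.
move=> [y -> py] [z yz pz]; case: (ltngtP d e) => // [de|ed]; exfalso.
- apply: py; exists (z * p ^+ (e - d).-1); apply: (mulIf (expf_neq0 d p0)).
  by rewrite yz -!mulrA -exprS -exprD addnS -addSn prednK ?subn_gt0 // subnK 1?ltnW.
- apply: pz; exists (y * p ^+ (d - e).-1); apply: (mulIf (expf_neq0 e p0)).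
  by rewrite -yz -!mulrA -exprS -exprD addnS -addSn prednK ?subn_gt0 // subnK 1?ltnW.
Qed.

Lemma valuation_eq x e : exact_power p x e -> valuation p x = e.
Proof.
move=> xe; apply: (exact_power_uniq _ xe).
have ex : exists d, [set d | exact_power p x d]%classic d by exists e.
exact: (xgetPex 0%N ex).
Qed.

Lemma exact_powerM x y d e : exact_power p x d -> exact_power p y e ->
  exact_power p (x * y) (d + e)%N.
Proof.
move=> [a -> pa] [b -> pb]; exists (a * b); last exact: prime_elt_not_dividesM.
by rewrite exprD mulrACA.
Qed.

Hypothesis ufdD : factorial_ring.

Lemma valuationP x : x != 0 -> exact_power p x (valuation p x).
Proof.
move=> x0; suff [e xe] : exists e, exact_power p x e.
  by rewrite (valuation_eq xe).
have [[u s] /= uu [ps xE]] := ufdD x0.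
have [N sN] := ubnP (size s); elim: N x u s sN uu ps xE {x0} => // N IHN.
move=> x u s sN uu ps xE; have [[y yE]|npx] := pselect (divides p x); last first.
  by exists 0%N, x; rewrite ?mulr1.
rewrite yE mulrC in xE.
have [v [t [vu pt ts xt]]] := factor_prime_cofactor pp ps uu xE.
have [|e [z zE npz]] := IHN y v t _ vu pt xt; first exact: leq_trans ts _.
by exists e.+1, z; rewrite // yE zE exprSr mulrA.
Qed.

Lemma valuationM x y : x != 0 -> y != 0 ->
  valuation p (x * y) = (valuation p x + valuation p y)%N.
Proof.
by move=> x0 y0; apply/valuation_eq/exact_powerM; apply: valuationP.
Qed.

Lemma valuation_expr x e : x != 0 -> valuation p (x * p ^+ e) = (valuation p x + e)%N.
Proof.
move=> x0; apply/valuation_eq/exact_powerM; first exact: valuationP.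
by exists 1; rewrite ?mul1r //; apply: prime_elt_not_divides_unit (unitr1 _).
Qed.

Lemma divides_exprE x e : x != 0 ->
  divides (p ^+ e) x <-> (e <= valuation p x)%N.
Proof.
move=> x0; split=> [[z zE]|ev].
  rewrite zE valuation_expr ?leq_addl //.
  by apply: contraNneq x0 => z0; rewrite zE z0 mul0r.
have [y {1}-> _] := valuationP x0.
by exists (y * p ^+ (valuation p x - e)); rewrite -mulrA -exprD subnK.
Qed.

End Valuation.

(** * Families of pairwise non-associate primes *)

Section PrimeFamily.
Variables (I : finType) (f : I -> D).
Hypotheses (f_prime : forall i, prime_elt (f i))
  (f_sep : forall i j, i != j -> ~ divides (f i) (f j)).

Lemma not_divides_others (e : I -> nat) i (r : seq I) : i \notin r ->
  ~ divides (f i) (\prod_(j <- r) f j ^+ e j).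
Proof.
elim: r => [_|j r IHr].
  by rewrite big_nil; apply: prime_elt_not_divides_unit => //; apply: unitr1.
rewrite inE negb_or big_cons => /andP[ij /IHr ir].
by apply: prime_elt_not_dividesM => //; apply: prime_elt_not_dividesX (f_sep ij).
Qed.

Lemma exact_power_monomial u (e : I -> nat) i : u \is a GRing.unit ->
  exact_power (f i) (u * \prod_j f j ^+ e j) (e i).
Proof.
move=> uu; exists (u * \prod_(j | j != i) f j ^+ e j).
  by rewrite [in LHS](bigD1 i) //= mulrCA mulrC.
apply: prime_elt_not_dividesM => //; first exact: prime_elt_not_divides_unit.
by rewrite -big_filter; apply: not_divides_others; rewrite mem_filter eqxx.
Qed.

Lemma monomial_eq u v (d e : I -> nat) :
    u \is a GRing.unit -> v \is a GRing.unit ->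
    u * \prod_j f j ^+ d j = v * \prod_j f j ^+ e j ->
  d =1 e.
Proof.
move=> uu vu E i; have := exact_power_monomial d i uu.
rewrite E => di; exact: exact_power_uniq di (exact_power_monomial e i vu).
Qed.

Lemma divides_expr_cancel p e x y : prime_elt p -> ~ divides p y ->
  divides (p ^+ e) (x * y) -> divides (p ^+ e) x.
Proof.
move=> pp py; elim: e x => [|e IHe] x; first by exists x; rewrite mulr1.
move=> [z xyE]; have : divides p (x * y) by exists (z * p ^+ e); rewrite xyE exprSr mulrA.
case/(prime_eltM pp)=> // -[t tE].
have [w wE] : divides (p ^+ e) t.
  apply: IHe; exists z; apply: (mulIf (prime_elt_neq0 pp)).
  by rewrite mulrAC -tE xyE exprSr mulrA.
by exists w; rewrite tE wE exprSr mulrA.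
Qed.

(** Powers of non-associate primes are coprime: the power of f i divides what
    is left after the other powers have been removed. *)
Lemma divides_prod_expr x e : (forall i, divides (f i ^+ e) x) ->
  divides ((\prod_i f i) ^+ e) x.
Proof.
move=> fx; rewrite -prodrXl.
elim: (index_enum I) (index_enum_uniq I) => [_|i r IHr /= /andP[ir /IHr[y yE]]].
  by exists x; rewrite big_nil mulr1.
have [z zE] : divides (f i ^+ e) y.
  have := fx i; rewrite yE; apply: divides_expr_cancel => //.
  exact: not_divides_others.
by exists z; rewrite big_cons yE zE mulrA.
Qed.

Lemma prime_seq_monomial s : {subset s <= codom f} ->
  exists e : I -> nat, \prod_(p <- s) p = \prod_i f i ^+ e i.
Proof.
elim: s => [_|p s IHs sf].
  by exists (fun=> 0%N); rewrite big_nil big1.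
have [e eE] : exists e : I -> nat, \prod_(p <- s) p = \prod_i f i ^+ e i.
  by apply: IHs => q qs; apply: sf; rewrite inE qs orbT.
have /codomP[i ->] : p \in codom f by apply: sf; rewrite inE eqxx.
exists (fun j => (j == i) + e j)%N; rewrite big_cons eE.
under [RHS]eq_bigr do rewrite exprD.
rewrite big_split /=; congr (_ * _); rewrite (bigD1 i) //= eqxx expr1 big1 ?mulr1 //.
by move=> j /negbTE ->.
Qed.

Lemma divides_monomial x N : divides x ((\prod_i f i) ^+ N) ->
  exists2 u, u \is a GRing.unit & exists e : I -> nat, x = u * \prod_i f i ^+ e i.
Proof.
move=> [y]; pose s := flatten (nseq N (codom f)).
have s_codom : {subset s <= codom f}.
  by move=> p /flattenP[t]; rewrite mem_nseq => /andP[_ /eqP ->].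
have -> : (\prod_i f i) ^+ N = 1 * \prod_(p <- s) p.
  rewrite mul1r /s; elim: N {s s_codom} => [|N IHN]; first by rewrite big_nil.
  by rewrite exprS IHN /= big_cat /= codomE big_map big_enum.
have ps : prime_seq s by move=> p /s_codom/codomP[i ->].
rewrite [RHS]mulrC => /esym xyE; have := factor_prime_prod ps (unitr1 D) xyE.
move=> [u [_ [s1 [s2 [uu _ ss -> _]]]]]; exists u => //.
have [p ps1|e ->] := @prime_seq_monomial s1; last by exists e.
by apply: s_codom; rewrite -(perm_mem ss) mem_cat ps1.
Qed.

End PrimeFamily.
End Factoriality.

(** * Gauss's lemma *)

Section Gauss.
Variable D : idomainType.
Implicit Types (p c : D) (f g a b : {poly D}).

Lemma polyC_divides p f : divides p%:P f <-> forall i, divides p f`_i.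
Proof.
split=> [[g -> i]|pf]; first by exists g`_i; rewrite coefMC.
have [g gE] := choice pf; exists (\poly_(i < size f) g i).
apply/polyP=> i; rewrite coefMC coef_poly; case: ltnP => [_|fi]; first exact: gE.
by rewrite nth_default // mul0r.
Qed.

Lemma polyC_unit c : (c%:P \is a GRing.unit) = (c \is a GRing.unit).
Proof.
rewrite poly_unitE size_polyC coefC eqxx.
by have [->|//] := eqVneq c 0; rewrite unitr0.
Qed.

(** If p divides a * b, it divides the product of the leading coefficients,
    hence one of the leading terms; removing that term, the claim follows by
    induction on the sizes. *)
Lemma prime_elt_polyC p : prime_elt p -> prime_elt p%:P.
Proof.
move=> pp; split; first by rewrite polyC_eq0 prime_elt_neq0.
  by rewrite polyC_unit prime_elt_nonunit.
have main N : forall a b, (size a + size b < N)%N ->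
    divides p%:P (a * b) -> divides p%:P a \/ divides p%:P b.
  elim: N => // N IHN a b sab pab.
  have [->|a0] := eqVneq a 0; first by left; exists 0; rewrite mul0r.
  have [->|b0] := eqVneq b 0; first by right; exists 0; rewrite mul0r.
  pose tail f := f - (lead_coef f)%:P * 'X^((size f).-1).
  have tailK f : tail f + (lead_coef f)%:P * 'X^((size f).-1) = f.
    by rewrite subrK.
  have size_tail f : f != 0 -> (size (tail f) < size f)%N.
    move=> f0; rewrite [X in (_ < X)%N](polySpred f0) ltnS; apply/leq_sizeP => i fi.
    rewrite coefB coefCM coefXn; case: eqVneq => [->|ne].
      by rewrite mulr1 lead_coefE subrr.
    rewrite mulr0 subr0 nth_default // (polySpred f0).
    by rewrite ltn_neqAle eq_sym ne.
  have div_lead f g : divides p (lead_coef f) ->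
      divides p%:P ((lead_coef f)%:P * 'X^((size f).-1) * g).
    by move=> [z ->]; do 2!apply: divides_mulr; exists z%:P; rewrite polyCM.
  have plead : divides p (lead_coef a * lead_coef b).
    by rewrite -lead_coefM; apply: (polyC_divides _ _).1.
  have [la|lb] := prime_eltM pp plead.
  - have : divides p%:P (tail a * b).
      rewrite /tail mulrBl; apply: dividesD => //.
      by rewrite -mulrN; apply: div_lead.
    have sz : (size (tail a) + size b < N)%N.
      by rewrite -ltnS; apply: leq_trans sab; rewrite ltnS ltn_add2r size_tail.
    move=> /(IHN _ _ sz)[ta|pb]; last by right.
    left; rewrite -(tailK a); apply: dividesD => //.
    by rewrite -[X in divides _ X]mulr1; apply: div_lead.
  - have : divides p%:P (a * tail b).
      rewrite /tail mulrBr; apply: dividesD => //.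
      by rewrite -mulrN mulrC mulNr -mulrN; apply: div_lead.
    have sz : (size a + size (tail b) < N)%N.
      by rewrite -ltnS; apply: leq_trans sab; rewrite ltnS ltn_add2l size_tail.
    move=> /(IHN _ _ sz)[pa|tb]; first by left.
    right; rewrite -(tailK b); apply: dividesD => //.
    by rewrite -[X in divides _ X]mulr1; apply: div_lead.
by move=> a b; apply: main (leqnn _).
Qed.

Definition primitive_poly f : Prop :=
  forall p, prime_elt p -> ~ divides p%:P f.

Hypothesis ufdD : factorial_ring D.

(** A prime constant dividing f divides its leading coefficient, so only
    finitely many can be taken out. *)
Lemma content_primitive f : f != 0 ->
  exists2 cg : D * {poly D}, cg.1 != 0 & f = cg.1%:P * cg.2 /\ primitive_poly cg.2.
Proof.
move=> f0; have lf0 : lead_coef f != 0 by rewrite lead_coef_eq0.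
have [[u s] /= uu [ps lfE]] := ufdD lf0.
have [N sN] := ubnP (size s); elim: N f u s sN uu ps lfE {f0 lf0} => // N IHN.
move=> f u s sN uu ps lfE.
have [[p [pp [g gE]]]|] := pselect (exists p, prime_elt p /\ divides p%:P f).
  have lE : p * lead_coef g = u * \prod_(q <- s) q.
    by rewrite -lfE gE lead_coefM lead_coefC mulrC.
  have [v [t [vu pt ts lgE]]] := factor_prime_cofactor pp ps uu lE.
  have [|[c h] /= c0 [hE hprim]] := IHN g v t _ vu pt lgE.
    exact: leq_trans ts _.
  exists (p * c, h); first by rewrite /= mulf_neq0 ?(prime_elt_neq0 pp).
  by split; rewrite //= gE hE polyCM mulrC mulrA.
move=> fprim; exists (1, f); rewrite ?oner_neq0 //; split; first by rewrite mul1r.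
by move=> p pp pf; apply: fprim; exists p.
Qed.

(** Each prime of c divides q * g and hence q, so c can be cancelled prime by
    prime. *)
Lemma primitive_divides c g a q :
  c != 0 -> primitive_poly g -> c%:P * a = q * g -> divides g a.
Proof.
move=> /ufdD[[u s] /= uu [ps ->]] gprim; elim: s q ps => [|p s IHs] q ps caE.
  exists (u^-1%:P * q); rewrite -mulrA -caE big_nil mulr1 mulrA -polyCM mulVr //.
  by rewrite mul1r.
have pp : prime_elt p by apply: ps; rewrite inE eqxx.
rewrite big_cons mulrCA polyCM -mulrA in caE.
have : divides p%:P (q * g) by eexists; rewrite -caE mulrC.
case/(prime_eltM (prime_elt_polyC pp)) => [[t tE]|/gprim//].
apply: (IHs t) => [r rs|]; first by apply: ps; rewrite inE rs orbT.
apply: (@mulfI _ p%:P); first by rewrite polyC_eq0 prime_elt_neq0.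
by rewrite caE tE mulrAC mulrC.
Qed.

(** Pseudo-divisibility is divisibility over the fraction field; for primitive
    divisors it descends to D. *)
Lemma primitive_dvdp g a : primitive_poly g -> Pdiv.Idomain.dvdp g a -> divides g a.
Proof.
move=> gprim /Pdiv.WeakIdomain.dvdpP[[c q] /= c0]; rewrite -mul_polyC.
exact: primitive_divides.
Qed.

(** For a primitive polynomial of positive degree this is irreducibility. *)
Definition indecomposable_poly g : Prop :=
  forall a b, g = a * b -> (size a <= 1)%N \/ (size b <= 1)%N.

Lemma indecomposable_irreducible_poly g :
  primitive_poly g -> (1 < size g)%N -> indecomposable_poly g ->
  Pdiv.Idomain.irreducible_poly g.
Proof.
move=> gprim g1 gind; split=> // q q1 qg.
have g0 : g != 0 by rewrite -size_poly_gt0 ltnW.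
have q0 : q != 0.
  by apply: contraNneq g0 => q0; move: qg; rewrite q0 Pdiv.CommonIdomain.dvd0p.
have [[c h] /= c0 [qE hprim]] := content_primitive q0.
have szh : size h = size q by rewrite qE mul_polyC size_scale.
have hg : Pdiv.Idomain.dvdp h g.
  apply: Pdiv.CommonIdomain.dvdp_trans qg.
  by rewrite qE Pdiv.CommonIdomain.dvdp_mull.
have [t tE] := primitive_dvdp hprim hg.
have szt : (size t <= 1)%N.
  have [//|] := gind _ _ tE; rewrite szh => szq.
  by move: q1; rewrite eqn_leq szq size_poly_gt0 q0.
have t0 : t`_0 != 0.
  have : t != 0 by move: g0; rewrite tE mulf_eq0 => /norP[].
  by rewrite {1}(size1_polyC szt) polyC_eq0.
apply/Pdiv.CommonIdomain.eqpP; exists (t`_0, c) => /=; first by rewrite t0.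
by rewrite tE qE -!mul_polyC -(size1_polyC szt) mulrCA.
Qed.

(** Such a polynomial stays irreducible over the fraction field, where Bezout
    relations make it prime; being primitive, it is already prime over D. *)
Lemma indecomposable_prime_elt g :
  primitive_poly g -> (1 < size g)%N -> indecomposable_poly g -> prime_elt g.
Proof.
move=> gprim g1 gind.
have girr := indecomposable_irreducible_poly gprim g1 gind.
split=> [||a b [z abE]].
- by rewrite -size_poly_gt0 ltnW.
- by rewrite poly_unitE; case: eqP g1 => // ->.
- have gab : Pdiv.Idomain.dvdp g (a * b).
    by rewrite abE Pdiv.CommonIdomain.dvdp_mull.
  have [cop|] := boolP (Pdiv.Idomain.coprimep g a).
    by right; apply: primitive_dvdp; rewrite // -(Pdiv.CommonIdomain.Gauss_dvdpr _ cop).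
  rewrite Pdiv.CommonIdomain.coprimep_def => /girr.
  move/(_ (Pdiv.CommonIdomain.dvdp_gcdl _ _)) => gcdE.
  left; apply: primitive_dvdp => //.
  by rewrite -(Pdiv.CommonIdomain.eqp_dvdl _ gcdE) Pdiv.CommonIdomain.dvdp_gcdr.
Qed.

(** The content factors in D; the primitive part is split until its factors
    are indecomposable. *)
Lemma factorial_poly : factorial_ring {poly D}.
Proof.
move=> f; have [N fN] := ubnP (size f); elim: N f fN => // N IHN f fN f0.
have [[c g] /= c0 [fE gprim]] := content_primitive f0.
have szg : size g = size f by rewrite fE mul_polyC size_scale.
have g0 : g != 0 by rewrite -size_poly_gt0 szg size_poly_gt0.
have [[v t] /= vu [pt cE]] := ufdD c0.
suff [[u s] /= uu [ps gE]] : exists2 us : {poly D} * seq {poly D},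
    us.1 \is a GRing.unit & prime_seq us.2 /\ g = us.1 * \prod_(q <- us.2) q.
  exists (v%:P * u, [seq p%:P | p <- t] ++ s) => /=.
    by rewrite unitrM polyC_unit vu.
  split; first apply: prime_seq_cat => //.
    by move=> _ /mapP[p /pt pp ->]; apply: prime_elt_polyC.
  rewrite big_cat big_map /= fE gE cE polyCM mulrACA.
  by rewrite (big_morph polyC (@polyCM D) (polyC1 D)).
have [g1|g1] := leqP (size g) 1.
  exists (g, [::]) => //=; last by rewrite big_nil mulr1.
  have gE := size1_polyC g1; rewrite gE polyC_unit.
  have a0 : g`_0 != 0 by move: g0; rewrite {1}gE polyC_eq0.
  have [[u [|p s]] /= uu [ps aE]] := ufdD a0; first by rewrite aE big_nil mulr1.
  have /gprim[] : prime_elt p by apply: ps; rewrite inE eqxx.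
  by exists (u * \prod_(q <- s) q)%:P; rewrite gE aE big_cons mulrCA mulrC polyCM.
have [gind|] := pselect (indecomposable_poly g).
  exists (1, [:: g]); rewrite /= ?unitr1 ?big_seq1 ?mul1r //; split=> // q.
  by rewrite inE => /eqP ->; apply: indecomposable_prime_elt.
move=> /existsNP[a /existsNP[b /not_implyP[gE]]].
move=> /not_orP[/negP + /negP]; rewrite -!ltnNge => a1 b1.
have a0 : a != 0 by rewrite -size_poly_gt0 ltnW.
have b0 : b != 0 by rewrite -size_poly_gt0 ltnW.
have szE : size g = (size a + size b).-1 by rewrite gE size_mul.
have [|[ua sa] /= uau [psa aE]] := IHN a _ a0.
  rewrite -ltnS; apply: leq_trans fN; rewrite ltnS -szg szE.
  by rewrite -(ltn_predK b1) addnS /= -addn1 leq_add2l -ltnS (ltn_predK b1).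
have [|[ub sb] /= ubu [psb bE]] := IHN b _ b0.
  rewrite -ltnS; apply: leq_trans fN; rewrite ltnS -szg szE.
  by rewrite -(ltn_predK a1) addSn /= addnC -addn1 leq_add2l -ltnS (ltn_predK a1).
exists (ua * ub, sa ++ sb); rewrite /= ?unitrM ?uau //.
by split; [apply: prime_seq_cat | rewrite gE aE bE big_cat mulrACA].
Qed.
End Gauss.

(** * Factoriality of multivariate polynomial rings *)

Section Transfer.
Variables (A B : idomainType) (h : {rmorphism A -> B}).
Hypothesis h_bij : bijective h.

Lemma rmorph_bij_divides x y : divides (h x) (h y) <-> divides x y.
Proof.
have [g hK gK] := h_bij; split=> -[z]; last by move=> ->; exists (h z); rewrite rmorphM.
by move=> yE; exists (g z); apply: (can_inj hK); rewrite rmorphM gK.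
Qed.

Lemma rmorph_bij_unit x : (h x \is a GRing.unit) = (x \is a GRing.unit).
Proof.
have [g hK gK] := h_bij; apply/idP/idP; last exact: rmorph_unit.
move=> /unitrP[z [zx _]]; apply/unitrPr; exists (g z); apply: (can_inj hK).
by rewrite rmorphM gK rmorph1 mulrC.
Qed.

Lemma rmorph_bij_prime_elt x : prime_elt (h x) -> prime_elt x.
Proof.
move=> hx; split.
- by apply: contraNneq (prime_elt_neq0 hx) => ->; rewrite rmorph0.
- by rewrite -rmorph_bij_unit prime_elt_nonunit.
- move=> a b /rmorph_bij_divides; rewrite rmorphM => /(prime_eltM hx).
  by case=> /rmorph_bij_divides; [left|right].
Qed.

Lemma rmorph_bij_factorial : factorial_ring B -> factorial_ring A.
Proof.
have [g hK gK] := h_bij; move=> ufdB x x0.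
have [|[u s] /= uu [ps hxE]] := ufdB (h x).
  by apply: contraNneq x0 => hx0; rewrite -(hK x) hx0 -(rmorph0 h) hK.
exists (g u, map g s) => /=; first by rewrite -rmorph_bij_unit gK.
split=> [_ /mapP[p /ps pp ->]|]; first by apply: rmorph_bij_prime_elt; rewrite gK.
apply: (can_inj hK); rewrite rmorphM gK rmorph_prod big_map hxE.
by congr (_ * _); apply: eq_bigr => p _; rewrite gK.
Qed.
End Transfer.

Section MpolyFactorial.
Variable k : fieldType.

Lemma muni_mcoeff n (p : {mpoly k[n.+1]}) (m : 'X_{1..n.+1}) :
  (muni p)`_(m ord_max)@_[multinom m (widen_ord (leqnSn n) i) | i < n] = p@_m.
Proof.
rewrite muniE coef_sum raddf_sum /= [in RHS](mpolyE p) raddf_sum /=.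
apply: eq_bigr => a _; rewrite coefZ coefXn -scalerAl !mcoeffZ mcoeffX.
congr (_ * _); have [<-|am] := eqVneq a m; first by rewrite eqxx mulr1 mcoeffX eqxx.
have [max_eq|_] := eqVneq (m ord_max) (a ord_max); last by rewrite mulr0 mcoeff0.
rewrite mulr1 mcoeffX; case: eqP => // /mnmP widen_eq; case/eqP: am.
apply/mnmP => i; have [j|] := unliftP ord_max i; last by move=> ->.
have -> : lift ord_max j = widen_ord (leqnSn n) j.
  by apply: val_inj; rewrite /= /bump leqNgt ltn_ord.
by move=> ->; have := widen_eq j; rewrite !mnmE.
Qed.

Lemma muniX n (a : 'X_{1..n.+1}) : muni ('X_[a] : {mpoly k[n.+1]}) =
  'X_[[multinom a (widen_ord (leqnSn n) i) | i < n]] *: 'X^(a ord_max).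
Proof. by rewrite muniE msuppX big_seq1 mcoeffX eqxx scale1r. Qed.

(** The last variable becomes the indeterminate, which makes factoriality
    provable by induction on the number of variables. *)
Lemma muni_bij n : bijective (@muni n k).
Proof.
pose g (q : {poly {mpoly k[n]}}) : {mpoly k[n.+1]} :=
  \sum_(i < size q) \sum_(m <- msupp q`_i)
    q`_i@_m *: 'X_[(mnmwiden m + U_(ord_max) *+ i)%MM].
have gK : cancel g (@muni n k).
  move=> q; rewrite raddf_sum /= -[RHS]coefK poly_def; apply: eq_bigr => i _.
  rewrite raddf_sum /= [in RHS](mpolyE q`_i) scaler_suml; apply: eq_bigr => m _.
  rewrite muniZ muniX -mul_mpolyC -scalerA; congr (_ *: (_ *: _)).
    congr 'X_[_]; apply/mnmP => j.
    by rewrite mnmE mnmDE mnmwiden_widen mulmnE mnm1E -val_eqE /= gtn_eqF ?addn0.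
  by rewrite mnmDE mnmwiden_ordmax mulmnE mnm1E eqxx mul1n.
have muni_inj : injective (@muni n k).
  by move=> p q pq; apply/mpolyP => m; rewrite -!muni_mcoeff pq.
by exists g; [apply: inj_can_sym gK muni_inj | exact: gK].
Qed.

Lemma factorial_mpoly n : factorial_ring {mpoly k[n]}.
Proof.
elim: n => [|n IHn].
  move=> p p0; exists (p, [::]) => /=; last by rewrite big_nil mulr1.
  have pC : p = (p@_0)%:MP.
    apply/mpolyP => m; rewrite mcoeffC; have -> : m = 0%MM by apply/mnmP; case.
    by rewrite eqxx mulr1.
  apply/andP; split; first exact/eqP.
  by rewrite unitfE; apply: contraNneq p0 => p00; rewrite pC p00 mpolyC0.
exact: (rmorph_bij_factorial (@muni_bij n) (factorial_poly IHn)).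
Qed.

End MpolyFactorial.

(** * The grading of k[x]/(F - 1) by residues modulo deg F *)

Lemma divn_ord_add n (j l : 'I_n) : ((j + l) %/ n = ~~ (j + l < n))%N.
Proof.
case: ltnP => jl; first exact: divn_small.
have n_gt0 : (0 < n)%N by apply: leq_ltn_trans (ltn_ord j).
rewrite -(subnK jl) divnDr // divnn n_gt0 divn_small //.
by rewrite ltn_subLR // -addSn leq_add // ltnW.
Qed.

Section ResidueGrading.
Variables (k : fieldType) (m n : nat) (F : {mpoly k[m]}).
Hypotheses (n_gt0 : (0 < n)%N) (F_homog : F \is n.-homog) (F_neq0 : F != 0).
Implicit Types (p h : {mpoly k[m]}).

Local Notation class := (quot_class (F - 1)).

Lemma class_F : class F = 1.
Proof.
by rewrite -(rmorph1 class); apply/quot_classP; exists 1; rewrite mul1r.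
Qed.

(** The component of the class of p in degrees congruent to s modulo n, lifted
    to a form: the pieces of degree q * n + s are brought to the common degree
    L * n + s by powers of F, whose class is 1. *)
Definition residue_part (s L : nat) p : {mpoly k[m]} :=
  \sum_(q < L) pihomog mdeg (q * n + s) p * F ^+ (L - q).

Lemma residue_part_zmod_morphism s L : zmod_morphism (residue_part s L).
Proof.
move=> p q; rewrite /residue_part -sumrB; apply: eq_bigr => i _.
by rewrite raddfB mulrBl.
Qed.
HB.instance Definition _ s L :=
  GRing.isZmodMorphism.Build {mpoly k[m]} {mpoly k[m]} (residue_part s L)
    (residue_part_zmod_morphism s L).

Lemma residue_part_homog s L p : residue_part s L p \is (L * n + s).-homog.
Proof.
apply: rpred_sum => q _.
have -> : (L * n + s = (q * n + s) + n * (L - q))%N.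
  by rewrite addnAC (mulnC q) -mulnDr subnKC 1?mulnC // ltnW.
by apply: dhomogM; [exact: pihomogP | exact: dhomogMn].
Qed.

Lemma residue_part_form s L h d : (s < n)%N -> (d < L * n)%N ->
    h \is d.-homog ->
  residue_part s L h = if (d %% n == s)%N then h * F ^+ (L - d %/ n) else 0.
Proof.
move=> sn dL hd; rewrite /residue_part; case: eqP => [ds|ds].
  have dnL : (d %/ n < L)%N by rewrite ltn_divLR.
  rewrite (bigD1 (Ordinal dnL)) //= -ds -divn_eq pihomog_dE // big1 ?addr0 //.
  move=> q qd; rewrite (pihomog_ne0 _ hd) ?mul0r //.
  apply: contraNneq qd => dE; apply/eqP/val_inj => /=.
  by rewrite dE divnMDl // divn_small ?addn0 // ltn_mod.
rewrite big1 // => q _; rewrite (pihomog_ne0 _ hd) ?mul0r //.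
by apply/eqP => dE; case: ds; rewrite dE modnMDl modn_small.
Qed.

(** The grading passes to the quotient: for h homogeneous, h * F and h have
    the same component, so the multiples of F - 1 have none.  The bound on L
    ensures that the sum sees all the degrees of p. *)
Lemma residue_part_ideal p : class p = 0 ->
  exists L0, forall s L, (s < n)%N -> (L0 <= L)%N -> residue_part s L p = 0.
Proof.
rewrite -(rmorph0 class) => /quot_classP[a]; rewrite subr0 => ->.
exists (msize a).+1 => s L sn aL.
rewrite {1}(@pihomog_partitionE _ _ mdeg (msize a) a) // mulr_suml raddf_sum.
apply: big1 => d _; set h := pihomog _ _ _; have hd : h \is d.-homog.
  exact: pihomogP.
have L_gt0 : (0 < L)%N by apply: leq_trans aL.
have dL : (d + n < L * n)%N.
  rewrite -(prednK L_gt0) mulSn addnC ltn_add2l.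
  apply: leq_trans (leq_pmulr _ n_gt0); apply: leq_trans (ltn_ord d) _.
  by rewrite -ltnS prednK.
rewrite mulrBr mulr1 raddfB /= (residue_part_form sn dL (dhomogM hd F_homog)).
rewrite (residue_part_form sn _ hd); last exact: leq_ltn_trans (leq_addr n d) dL.
rewrite modnDr; case: ifP => _; last by rewrite subrr.
rewrite -mulrA -exprS divnDr // divnn n_gt0 addn1 -subSn ?subrr //.
by rewrite ltn_divLR //; apply: leq_ltn_trans dL; apply: leq_addr.
Qed.

Lemma class_residue_parts p L : (msize p <= L * n)%N ->
  class p = \sum_(s < n) class (residue_part s L p).
Proof.
move=> pL; have pE := @pihomog_partitionE _ _ mdeg _ p pL.
have partE s : residue_part s L p =
    \sum_(d < L * n) residue_part s L (pihomog mdeg d p).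
  by rewrite {1}pE raddf_sum.
under [RHS]eq_bigr do rewrite partE raddf_sum.
rewrite {1}pE raddf_sum.
rewrite exchange_big /=; apply: eq_bigr => d _; set h := pihomog _ _ _.
have hd : h \is d.-homog by apply: pihomogP.
have dn : (d %% n < n)%N by rewrite ltn_mod.
rewrite (bigD1 (Ordinal dn)) //= (residue_part_form dn _ hd) // eqxx.
rewrite rmorphM rmorphXn /= class_F expr1n mulr1 big1 ?addr0 // => s sd.
rewrite (residue_part_form _ _ hd) // ifN ?rmorph0 //.
by apply: contra sd => /eqP ds; apply/eqP/val_inj.
Qed.

(** Uniqueness of the homogeneous lift, up to powers of F. *)
Lemma homog_congr d e A B : A \is d.-homog -> B \is e.-homog -> A != 0 ->
  class A = class B -> exists s t, A * F ^+ s = B * F ^+ t.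
Proof.
move=> Aa Bb A0 AB; have [|L0 L0P] := @residue_part_ideal (A - B).
  by rewrite raddfB /= AB subrr.
pose L := (L0 + (d + e).+1)%N.
have ltL c : (c <= d + e)%N -> (c < L * n)%N.
  move=> cde; apply: leq_trans (leq_pmulr _ n_gt0).
  by apply: leq_trans (leq_addl _ _).
have dn : (d %% n < n)%N by rewrite ltn_mod.
have := L0P _ L dn (leq_addr _ _); rewrite raddfB /=.
rewrite (residue_part_form dn (ltL _ (leq_addr _ _)) Aa) eqxx.
rewrite (residue_part_form dn (ltL _ (leq_addl _ _)) Bb).
case: ifP => _ => [/subr0_eq AB'|/eqP]; first by do 2!eexists; exact: AB'.
by rewrite subr0 mulf_eq0 (negbTE A0) expf_eq0 (negbTE F_neq0) andbF.
Qed.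

(** The components of the identity w * w' = 1.  The extra factor F when
    j + l < n brings all the products in one residue class to the same
    degree. *)
Lemma unit_components M (W W' : 'I_n -> {mpoly k[m]}) :
    (forall j : 'I_n, W j \is (M * n + j).-homog) ->
    (forall j : 'I_n, W' j \is (M * n + j).-homog) ->
    class (\sum_j W j) * class (\sum_j W' j) = 1 ->
  forall s : 'I_n,
    \sum_(j < n) \sum_(l < n | ((j + l) %% n == s)%N) W j * W' l * F ^+ (j + l < n)%N =
    if s == 0%N :> nat then F ^+ (M + M).+1 else 0.
Proof.
move=> Wh W'h WW' s.
have [|L0 L0P] := @residue_part_ideal ((\sum_j W j) * (\sum_j W' j) - 1).
  by rewrite rmorphB rmorphM /= WW' rmorph1 subrr.
pose K := (M + M).+1; pose L := (L0 + K.+1)%N.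
have := L0P _ L (ltn_ord s) (leq_addr _ _); rewrite raddfB /=.
rewrite (residue_part_form (ltn_ord s) _ (dhomog1 _ _)); last first.
  by rewrite muln_gt0 n_gt0 /L addnS.
rewrite mod0n div0n subn0 mul1r => /subr0_eq WW'E.
have FL : F ^+ (L - K) != 0 by rewrite expf_neq0.
apply: (mulIf FL); rewrite -[RHS]mulrC.
have -> : F ^+ (L - K) * (if s == 0%N :> nat then F ^+ K else 0) =
          if (0 == s)%N then F ^+ L else 0.
  rewrite [(0 == s)%N]eq_sym; case: ifP => _; last by rewrite mulr0.
  by rewrite -(exprD F) subnK // /L addnS -addSn leq_addl.
rewrite -WW'E mulr_suml [in RHS]mulr_suml raddf_sum; apply: eq_bigr => j _.
rewrite mulr_suml mulr_sumr raddf_sum [LHS]big_mkcond; apply: eq_bigr => l _ /=.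
have dE : (M * n + j + (M * n + l) = (M + M) * n + (j + l))%N.
  by rewrite addnACA mulnDl.
have jl2 : (j + l < 2 * n)%N by rewrite mul2n -addnn -addSn leq_add // ltnW.
rewrite (residue_part_form _ _ (dhomogM (Wh j) (W'h l))) // dE; last first.
  apply: (@leq_trans ((M + M) * n + 2 * n)); first by rewrite ltn_add2l.
  by rewrite -mulnDl leq_mul2r addn2 leq_addl orbT.
rewrite modnMDl; case: ifP => // _.
rewrite divnMDl // -[LHS]mulrA -(exprD F); congr (_ * F ^+ _).
rewrite divn_ord_add.
have -> : (L - K = L0.+1)%N by rewrite /L addnS -addSn addnK.
rewrite /L /K; case: (j + l < n)%N => /=.
  by rewrite addn0 add1n !addnS -!addSn addnK.
by rewrite add0n addn1 addnS -addSn addnK.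
Qed.
End ResidueGrading.

(** * Homogeneity of the units of k[x]/(F - 1) *)

Lemma homog_divides_leq (k : fieldType) (m d e : nat) (A B : {mpoly k[m]}) :
    A \is d.-homog -> B \is e.-homog -> B != 0 -> divides A B -> (d <= e)%N.
Proof.
move=> Ad Be B0 [z BE].
have z0 : z != 0 by apply: contraNneq B0 => z0; rewrite BE z0 mul0r.
have A0 : A != 0 by apply: contraNneq B0 => A0; rewrite BE A0 mulr0.
have -> := dhomog_uniq A0 Ad (dhomog_msize Ad).
have -> := dhomog_uniq B0 Be (dhomog_msize Be).
rewrite BE msizeM //.
have : (0 < msize z)%N by rewrite lt0n msize_poly_eq0.
case: (msize z) => // c _; rewrite addSn /= -!subn1.
by rewrite leq_sub2r ?leq_addl.
Qed.

Section HomogeneousUnits.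
Variables (k : fieldType) (m n : nat) (I : finType) (f : I -> {mpoly k[m]}).
Hypotheses (f_prime : forall i, prime_elt (f i))
  (f_sep : forall i j, i != j -> ~ divides (f i) (f j)).
Local Notation F := (\prod_i f i).
Hypotheses (n_gt0 : (0 < n)%N) (F_homog : F \is n.-homog).
Local Notation class := (quot_class (F - 1)).

Let F_neq0 : F != 0.
Proof. by apply/prodf_neq0 => i _; apply: prime_elt_neq0. Qed.

Let mpolyU := @factorial_mpoly k m.

Section Components.
Variables (M : nat) (W W' : 'I_n -> {mpoly k[m]}).
Hypotheses (W_homog : forall j : 'I_n, W j \is (M * n + j).-homog)
  (W'_homog : forall j : 'I_n, W' j \is (M * n + j).-homog)
  (WW' : class (\sum_j W j) * class (\sum_j W' j) = 1).

Let G (j l : 'I_n) := W j * W' l * F ^+ (j + l < n)%N.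

Let G_sum : forall s : 'I_n,
    \sum_(j < n) \sum_(l < n | ((j + l) %% n == s)%N) G j l =
    if s == 0%N :> nat then F ^+ (M + M).+1 else 0.
Proof. exact: unit_components. Qed.

Lemma component_prod_neq0 :
  exists j l : 'I_n, ((j + l) %% n = 0)%N /\ G j l != 0.
Proof.
apply: contrapT => noG; have := G_sum (Ordinal n_gt0); rewrite /= => /esym.
rewrite [X in _ = X]big1 => [|j _]; first by apply/eqP/expf_neq0.
rewrite big1 // => l /eqP jl; apply: contrapT => /eqP G0.
by apply: noG; exists j, l.
Qed.

Lemma component_prod_homog j l : G j l \is ((M + M).+1 * n + (j + l) %% n)%N.-homog.
Proof.
have -> : ((M + M).+1 * n + (j + l) %% n =
           (M * n + j) + (M * n + l) + n * (j + l < n))%N.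
  by have := divn_eq (j + l) n; rewrite divn_ord_add; case: ltnP; lia.
by apply: dhomogM; [apply: dhomogM | apply: dhomogMn].
Qed.

(** Let a and b be the components of least value of the two units.  The
    other products in the residue class of a + b have a larger valuation than
    G a b, so the sum over this class has exactly the valuation of G a b; as
    this sum is a power of F or 0, it is the power of F, and a + b is 0 modulo
    n.  Since G a b has the least value among all products, this bounds the
    value of G j l from below. *)
Lemma component_valuation i j l : G j l != 0 ->
  ((M + M).+1 * n + (j + l) %% n <= n * valuation (f i) (G j l))%N.
Proof.
pose v := valuation (f i).
have valM x y : x != 0 -> y != 0 -> v (x * y) = (v x + v y)%N.
  exact: valuationM.
have vFX e : v (F ^+ e) = e.
  rewrite -prodrXl -[X in v X]mul1r.
  by apply/valuation_eq/exact_power_monomial => //; apply: unitr1.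
(* key V j is n * (v (V j) - j / n), shifted by n - 1 to be a natural number.
   Its remainder modulo n determines j, so its minimum over the nonzero
   components is attained only once. *)
pose key (V : 'I_n -> {mpoly k[m]}) (j : 'I_n) := (n * v (V j) + (n.-1 - j))%N.
have key_inj V (x y : 'I_n) : key V x = key V y -> x = y.
  move=> xy; have xn := ltn_ord x; have yn := ltn_ord y.
  have : ((n.-1 - x) %% n = (n.-1 - y) %% n)%N.
    have := congr1 (modn^~ n) xy.
    by rewrite /key ![(n * v _)%N]mulnC !modnMDl.
  by rewrite !modn_small; [move=> ?; apply: val_inj => /=; lia | lia | lia].
have keyG x y : G x y != 0 ->
    (n * v (G x y) + n = key W x + key W' y + (x + y) %% n + 2)%N.
  rewrite !mulf_eq0 !negb_or => /andP[/andP[Wx W'y] _].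
  have xn := ltn_ord x; have yn := ltn_ord y.
  rewrite /G !valM ?mulf_neq0 ?expf_neq0 // vFX /key.
  by have := divn_eq (x + y) n; rewrite divn_ord_add; case: ltnP; lia.
rewrite {1}/G !mulf_eq0 !negb_or => /andP[/andP[Wj W'l] FX].
have Gjl : G j l != 0 by rewrite !mulf_neq0.
pose a := [arg min_(x < j | W x != 0) key W x].
pose b := [arg min_(y < l | W' y != 0) key W' y].
have [Wa amin] : W a != 0 /\ forall x, W x != 0 -> (key W a <= key W x)%N.
  by rewrite /a; case: arg_minnP.
have [W'b bmin] : W' b != 0 /\ forall y, W' y != 0 -> (key W' b <= key W' y)%N.
  by rewrite /b; case: arg_minnP.
have Gab : G a b != 0 by rewrite !mulf_neq0 ?expf_neq0.
have ab_lt : ((a + b) %% n < n)%N by rewrite ltn_mod.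
pose e := v (G a b).
have others x y : (x, y) != (a, b) -> ((x + y) %% n = (a + b) %% n)%N ->
    divides (f i ^+ e.+1) (G x y).
  move=> xy_ab xyE; have [->|Gxy] := eqVneq (G x y) 0.
    by exists 0; rewrite mul0r.
  apply/divides_exprE => //.
  have := keyG _ _ Gxy; have := keyG _ _ Gab; rewrite xyE -/e => keyab keyxy.
  move: (Gxy); rewrite !mulf_eq0 !negb_or => /andP[/andP[/amin ax /bmin by'] _].
  have : (key W a + key W' b != key W x + key W' y)%N.
    apply: contra xy_ab => /eqP kE; apply/eqP.
    have [/key_inj-> /key_inj->//] : key W x = key W a /\ key W' y = key W' b.
    move: ax by' kE; move: (key W a) (key W x) (key W' b) (key W' y).
    by clear; lia.
  rewrite -(ltn_pmul2l n_gt0); move: keyab keyxy ax by'.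
  move: (key W a) (key W x) (key W' b) (key W' y) (n * e)%N (n * v (G x y))%N.
  by move: ((a + b) %% n)%N; clear; lia.
have : ~ divides (f i ^+ e.+1) (if ((a + b) %% n == 0)%N then F ^+ (M + M).+1 else 0).
  have := G_sum (Ordinal ab_lt); rewrite /= => <-.
  rewrite pair_big_dep /= (bigD1 (a, b)) //= => -[z zE].
  move: zE; set rest := \sum_(_ | _) _ => zE.
  have : divides (f i ^+ e.+1) (G a b).
    rewrite -[G a b](addrK rest) zE; apply: dividesD; first by exists z.
    rewrite -mulN1r; apply/divides_mull/divides_sum => -[x y] /=.
    by move=> /andP[/eqP xyE xy_ab]; apply: others.
  by move/divides_exprE => /(_ (f_prime i) mpolyU Gab); rewrite ltnn.
case: eqP => [ab0|_]; last by case; exists 0; rewrite mul0r.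
move=> Fe; have {Fe} Me : ((M + M).+1 <= e)%N.
  rewrite -ltnS ltnNge -[X in (_ <= X)%N]vFX; apply/negP => eF; apply: Fe.
  by apply/divides_exprE => //; apply: expf_neq0.
have := keyG _ _ Gab; have := keyG _ _ Gjl; rewrite ab0 -/e -/v.
have := amin _ Wj; have := bmin _ W'l.
move: (key W a) (key W' b) (key W j) (key W' l) (v (G j l)) ((j + l) %% n)%N Me.
by move: (e); clear; nia.
Qed.

(** The product of a component of nonzero residue with W' l would be divisible
    by a power of F of larger degree. *)
Lemma component_unique (j l p : 'I_n) : ((j + l) %% n = 0)%N -> G j l != 0 ->
  p != j -> W p = 0.
Proof.
move=> jl0 Gjl pj; apply: contrapT => /eqP Wp.
have W'l : W' l != 0 by move: Gjl; rewrite !mulf_eq0 !negb_or => /andP[/andP[]].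
have Gpl : G p l != 0 by rewrite !mulf_neq0 ?expf_neq0.
have pl_gt0 : (0 < (p + l) %% n)%N.
  rewrite lt0n; apply: contra pj => /eqP pl0.
  have : (p == j %[mod n])%N by rewrite -(eqn_modDr l) pl0 jl0.
  by rewrite !modn_small.
have FG : divides (F ^+ (M + M).+2) (G p l).
  apply: divides_prod_expr => // i; apply/divides_exprE => //.
  have := component_valuation i Gpl; rewrite -ltnS => Gi.
  by rewrite -(ltn_pmul2l n_gt0); nia.
have := homog_divides_leq (dhomogMn (M + M).+2 F_homog) (component_prod_homog p l) Gpl FG.
have : ((p + l) %% n < n)%N by rewrite ltn_mod.
nia.
Qed.

(** A unit reduces to one component W j, which then divides all the terms of
    the sum that is equal to a power of F. *)
Lemma unit_component : exists2 j,
  class (\sum_j W j) = class (W j) & divides (W j) (F ^+ (M + M).+1).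
Proof.
have [j [l [jl0 Gjl]]] := component_prod_neq0.
have Wp p : p != j -> W p = 0 by apply: component_unique jl0 Gjl.
exists j; first by rewrite [\sum_(_ < _) _](bigD1 j) //= [\sum_(_ | _) _]big1 ?addr0.
have := G_sum (Ordinal n_gt0); rewrite /= => <-.
apply: divides_sum => p _; apply: divides_sum => q _.
have [->|/Wp Wp0] := eqVneq p j; last first.
  by rewrite /G Wp0 !mul0r; exists 0; rewrite mul0r.
by rewrite /G -mulrA; apply: divides_mulr; exists 1; rewrite mul1r.
Qed.

End Components.

Lemma unit_class_monomial w w' : class w * class w' = 1 ->
  exists2 c : k, c != 0 &
    exists e : I -> nat, class w = class (c%:MP * \prod_i f i ^+ e i).
Proof.
pose M := (msize w + msize w')%N; move=> ww'.
have wM : (msize w <= M * n)%N by apply: leq_trans (leq_pmulr _ n_gt0); apply: leq_addr.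
have w'M : (msize w' <= M * n)%N by apply: leq_trans (leq_pmulr _ n_gt0); apply: leq_addl.
have wE : class w = class (\sum_(j < n) residue_part n F j M w).
  by rewrite raddf_sum -(class_residue_parts F n_gt0 wM).
have w'E : class w' = class (\sum_(j < n) residue_part n F j M w').
  by rewrite raddf_sum -(class_residue_parts F n_gt0 w'M).
have [||| j wj] := @unit_component M (fun j => residue_part n F j M w)
    (fun j => residue_part n F j M w').
- by move=> j; apply: residue_part_homog.
- by move=> j; apply: residue_part_homog.
- by rewrite -wE -w'E.
case/(divides_monomial f_prime) => u uu [e uE].
(* The unit u of k[x] is the constant u@_0. *)
exists u@_0; last first.
  exists e; rewrite wE wj uE.
  by case/andP: uu => /eqP <- _.
by rewrite -unitfE; case/andP: uu.
Qed.

End HomogeneousUnits.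

(** * The group of units modulo scalars *)

Section UnitSums.
Variable A : comPzRingType.

Lemma unit_valMn (u : units A) (n : nat) : unit_val (u *+ n) = unit_val u ^+ n.
Proof. by elim: n => [//|n IHn]; rewrite mulrS unit_valD IHn exprS. Qed.

Lemma unit_val_sum (I : finType) (u : I -> units A) (e : I -> nat) :
  unit_val (\sum_i u i *+ e i) = \prod_i unit_val (u i) ^+ e i.
Proof.
rewrite (big_morph (@unit_val A) (@unit_valD A) (unit_val0 A)).
by apply: eq_bigr => i _; rewrite unit_valMn.
Qed.
End UnitSums.

Section UnitsModScalars.
Variables (k : fieldType) (m r : nat) (f : 'I_r -> {mpoly k[m]}).
Local Notation F := (\prod_(i < r) f i).

Definition unit_class (u : units (coord_ring f)) : units_mod_scalars f :=
  \pi_{ideal_quot (scalar_units f)} u.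

Lemma unit_class_zmod_morphism : zmod_morphism unit_class.
Proof. by move=> u v; rewrite /unit_class piE. Qed.
HB.instance Definition _ :=
  GRing.isZmodMorphism.Build (units (coord_ring f)) (units_mod_scalars f)
    unit_class unit_class_zmod_morphism.

Lemma unit_class_eq0 u : unit_class u = 0 <-> u \in scalar_units f.
Proof.
have := Quotient.idealrBE (scalar_units f) u 0; rewrite subr0 => ->.
by rewrite -(raddf0 unit_class); split=> /eqP.
Qed.

Lemma coord_classM : {morph coord_class f : p q / p * q}.
Proof. exact: rmorphM. Qed.

Lemma unit_val_factors (e : 'I_r -> nat) :
  unit_val (\sum_i factor_unit f i *+ e i) = coord_class f (\prod_i f i ^+ e i).
Proof.
rewrite unit_val_sum /coord_class rmorph_prod; apply: eq_bigr => i _.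
by rewrite rmorphXn.
Qed.

Lemma unit_class_factors (e : 'I_r -> nat) :
  unit_class (\sum_i factor_unit f i *+ e i) = \sum_i factor_class f i *+ e i.
Proof. by rewrite raddf_sum; apply: eq_bigr => i _; rewrite raddfMn. Qed.

Lemma unit_class_eq_factors u c (e : 'I_r -> nat) : c != 0 ->
    unit_val u = coord_class f (c%:MP * \prod_i f i ^+ e i) ->
  unit_class u = \sum_i factor_class f i *+ e i.
Proof.
move=> c0 uE; rewrite -unit_class_factors; apply/subr0_eq; rewrite -raddfB.
apply/unit_class_eq0/scalar_unitsP; exists c => //.
rewrite unit_valD unit_valN uE coord_classM.
by rewrite -unit_val_factors -mulrA unit_valV mulr1.
Qed.

Lemma sum_factor_class : \sum_i factor_class f i = 0.
Proof.
rewrite (eq_bigr (fun i => factor_class f i *+ 1)) // -unit_class_factors.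
apply/unit_class_eq0/scalar_unitsP; exists 1; first exact: oner_neq0.
rewrite unit_val_factors; under eq_bigr do rewrite expr1.
by rewrite mpolyC1 /coord_class class_F rmorph1.
Qed.

Variable n : nat.
Hypotheses (f_prime : forall i, prime_elt (f i))
  (f_sep : forall i j, i != j -> ~ divides (f i) (f j))
  (f_homog : forall i, exists d, f i \is d.-homog)
  (n_gt0 : (0 < n)%N) (F_homog : F \is n.-homog).

Lemma factor_class_generate (v : units_mod_scalars f) :
  exists e : 'I_r -> nat, v = \sum_i factor_class f i *+ e i.
Proof.
pose u := repr v; have vE : v = unit_class u by rewrite /unit_class reprK.
pose w := repr (unit_val u); pose w' := repr (unit_inv u).
have wE : unit_val u = coord_class f w by rewrite /coord_class quot_class_repr.
have w'E : unit_inv u = coord_class f w'.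
  by rewrite /coord_class quot_class_repr.
have [|c c0 [e uE]] := @unit_class_monomial _ _ n _ f f_prime f_sep n_gt0 F_homog w w'.
  by rewrite -/(coord_class f w) -/(coord_class f w') -wE -w'E unit_valV.
exists e; rewrite vE; apply: (unit_class_eq_factors c0).
by rewrite wE.
Qed.

Lemma homog_monomial (e : 'I_r -> nat) : exists d, \prod_i f i ^+ e i \is d.-homog.
Proof.
apply: (big_ind (fun A : {mpoly k[m]} => exists d, A \is d.-homog)) => [|A B [d Ad] [e0 Be]|i _].
- by exists 0%N; apply: dhomog1.
- by exists (d + e0)%N; apply: dhomogM.
- by have [d fd] := f_homog i; exists (d * e i)%N; apply: dhomogMn.
Qed.

(** Positive and negative parts of a relation give two monomials whose classes
    agree up to a scalar; they agree in k[x] after multiplication by F ^+ s and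
    F ^+ t, so every coefficient is t - s. *)
Lemma factor_class_relation (a : 'I_r -> int) :
  \sum_i factor_class f i *~ a i = 0 -> forall i j, a i = a j.
Proof.
have a_diff i : exists pq : nat * nat, a i = pq.1%:Z - pq.2%:Z.
  case: (a i) => d; first by exists (d, 0%N); rewrite subr0.
  by exists (0%N, d.+1); rewrite sub0r NegzE.
have [p pP] := choice a_diff.
under eq_bigr do rewrite pP mulrzBr -!pmulrn.
rewrite sumrB -!unit_class_factors -raddfB => /unit_class_eq0/scalar_unitsP[c c0].
pose P := \sum_i factor_unit f i *+ (p i).1.
pose Q := \sum_i factor_unit f i *+ (p i).2.
rewrite -/P -/Q => PQ.
have {PQ} : unit_val P = coord_class f c%:MP * unit_val Q.
  by rewrite -PQ unit_valD unit_valN -mulrA units_opp_proof mulr1.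
rewrite !unit_val_factors -coord_classM => PQ.
have [d Pd] := homog_monomial (fun i => (p i).1).
have [e Qe] := homog_monomial (fun i => (p i).2).
have cQe : c%:MP * \prod_i f i ^+ (p i).2 \is e.-homog.
  by rewrite mul_mpolyC; apply: dhomogZ.
have F0 : F != 0 by apply/prodf_neq0 => i _; apply: prime_elt_neq0.
have P0 : \prod_i f i ^+ (p i).1 != 0.
  by apply/prodf_neq0 => i _; apply/expf_neq0/prime_elt_neq0.
have [s [t]] := homog_congr n_gt0 F_homog F0 Pd cQe P0 PQ.
rewrite -!prodrXl -mulrA -!big_split /= -[LHS]mul1r.
under [in LHS]eq_bigr do rewrite -exprD.
under [in RHS]eq_bigr do rewrite -exprD.
have cu : (c%:MP : {mpoly k[m]}) \is a GRing.unit.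
  by apply/andP; rewrite mcoeffC eqxx mulr1 unitfE.
move/(monomial_eq f_prime f_sep (unitr1 _) cu) => pq i j.
by have /= := pq i; have /= := pq j; rewrite !pP; lia.
Qed.
End UnitsModScalars.

Theorem theorem3p14 (k : closedFieldType) (m r : nat)
    (hm : (2 <= m)%N) (hr : (2 <= r)%N)
    (f : 'I_r -> {mpoly k[m]})
    (f_irr : forall i, irreducible_elt (f i))
    (f_form : forall i, is_form (f i))
    (f_distinct : forall i j, i != j -> zero_set (f i) <> zero_set (f j))
    (deg_unit_ideal :
       exists a : 'I_r -> int, \sum_(i < r) a i * (mdegree (f i))%:Z = 1)
    (n_unit : ((\sum_(i < r) mdegree (f i))%N%:R : k) \is a GRing.unit) :
  is_Zbasis (fun i : 'I_r.-1 => factor_class f (widen_ord (leq_pred r) i)).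
Proof.
have f_prime i : prime_elt (f i).
  by apply: irreducible_prime => //; apply: factorial_mpoly.
have f_sep i j : i != j -> ~ divides (f i) (f j).
  move=> ij [z fjE]; have [_ _ /(_ _ _ fjE)[zu|fiu]] := f_irr j; last first.
    by have [_] := f_irr i; rewrite fiu.
  apply: (f_distinct _ _ ij); apply/seteqP; split=> x; rewrite /zero_set /= fjE rmorphM /=.
    by move=> ->; rewrite mulr0.
  move/eqP; rewrite mulf_eq0 => /orP[/eqP zx|/eqP//].
  have := rmorph_unit (meval x) zu; rewrite /= zx unitr0 //.
pose n := (\sum_(i < r) mdegree (f i))%N.
have n_gt0 : (0 < n)%N.
  by rewrite lt0n; apply: contraTneq n_unit; rewrite -/n => ->; rewrite unitr0.
have F_homog : \prod_(i < r) f i \is n.-homog.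
  rewrite /n; apply: (big_rec2 (fun (A : {mpoly k[m]}) d => A \is d.-homog)) => [|i A d _ Ad].
    exact: dhomog1.
  by apply: dhomogM => //; apply: f_form.
have f_homog i : exists d, f i \is d.-homog by eexists; apply: f_form.
clear hm f_irr f_form f_distinct deg_unit_ideal n_unit.
case: r hr f f_prime f_sep @n n_gt0 F_homog f_homog => // r _ f f_prime f_sep n n_gt0 F_homog f_homog.
have widenE i : widen_ord (leq_pred r.+1) i = widen_ord (leqnSn r) i.
  exact: val_inj.
split=> [v|e e0 i].
  have [e ->] := factor_class_generate f_prime f_sep n_gt0 F_homog v.
  (* The last class is minus the sum of the others. *)
  exists (fun i => (e (widen_ord (leqnSn r) i))%:Z - (e ord_max)%:Z).
  have /esym/eqP := sum_factor_class f.
  rewrite big_ord_recr /= eq_sym addr_eq0 => /eqP maxE.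
  rewrite big_ord_recr /= -[factor_class f ord_max]opprK -maxE mulNrn -sumrMnl.
  rewrite -sumrB; apply: eq_bigr => i _.
  by rewrite widenE mulrzBr -!pmulrn.
(* The given relation extended by the coefficient 0 at the last index, to which
   all the others are then equal. *)
pose a j := if unlift ord_max j is Some j' then e j' else 0.
have aE j : a (widen_ord (leqnSn r) j) = e j.
  have -> : widen_ord (leqnSn r) j = lift ord_max j.
    by apply: val_inj; rewrite /= /bump leqNgt ltn_ord.
  by rewrite /a liftK.
have amax : a ord_max = 0 by rewrite /a unlift_none.
rewrite -aE -amax; apply: (factor_class_relation f_prime f_sep f_homog n_gt0 F_homog).
rewrite big_ord_recr /= amax mulr0z addr0; apply: (etrans _ e0); apply: eq_bigr => j _.
by rewrite aE widenE.
Qed.
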